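(* Let $m\geq 1$ and $0\leq l\leq m$, let $1\leq i_1\leq\cdots\leq i_l$ and $1\leq i_{l+1}\leq\cdots\leq i_m$ be integers, and let $q\geq 2$ be an integer. For a composition $\theta=(\theta_1,\theta_2,\ldots,\theta_p)\in\mathcal{C}_m$ (where $p$ is the number of parts of $\theta$), a permutation $\rho\in\mathcal{S}_m$ and $c=1,2,\ldots,p$, put $$\lambda_c=\sum_{k=1}^{\theta_c}\chi_{\mathbb{N}}\big(\rho(\theta_1+\cdots+\theta_{c-1}+k)-l\big),$$ $$\tilde{T}_c(\theta,\rho)=\begin{cases}\overline{i_{\rho(\theta_1+\cdots+\theta_{c-1}+1)}+\cdots+i_{\rho(\theta_1+\cdots+\theta_c)}}, & \text{if }\lambda_c\text{ is odd},\\ i_{\rho(\theta_1+\cdots+\theta_{c-1}+1)}+\cdots+i_{\rho(\theta_1+\cdots+\theta_c)}, & \text{if }\lambda_c\text{ is even},\end{cases}$$ $$\hat{T}_1(\theta,\rho)=\begin{cases}\overline{q+i_{\rho(1)}+\cdots+i_{\rho(\theta_1)}}, & \text{if }\lambda_1\text{ is odd},\\ q+i_{\rho(1)}+\cdots+i_{\rho(\theta_1)}, & \text{if }\lambda_1\text{ is even}.\end{cases}$$ Then $$S_{i_1\cdots i_l\bar{i}_{l+1}\cdots\bar{i}_m,q}=\sum_{\theta\in\mathcal{C}_m}\sum_{\rho\in\mathcal{S}_m}\frac{(-1)^{\lambda_1+\cdots+\lambda_p}}{\theta_1!\cdots\theta_p!}\Big\{\zeta\big(q,\tilde{T}_1(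\theta,\rho),\ldots,\tilde{T}_p(\theta,\rho)\big)+\zeta\big(\hat{T}_1(\theta,\rho),\tilde{T}_2(\theta,\rho),\ldots,\tilde{T}_p(\theta,\rho)\big)\Big\}.$$
   Context: Harmonic numbers and alternating harmonic numbers: $H_n^{(r)}=\sum_{k=1}^n\frac{1}{k^r}$ and $\bar{H}_n^{(r)}=\sum_{k=1}^n\frac{(-1)^{k-1}}{k^r}$ for positive integers $n,r$. Alternating Euler sums (first kind): $$S_{i_1\cdots i_l\bar{i}_{l+1}\cdots\bar{i}_m,q}=\sum_{n=1}^{\infty}\frac{H_n^{(i_1)}\cdots H_n^{(i_l)}\bar{H}_n^{(i_{l+1})}\cdots\bar{H}_n^{(i_m)}}{n^q}.$$ Alternating multiple zeta values: for positive integers $s_j$ and signs $\sigma_j=\pm1$ with $(s_1,\sigma_1)\neq(1,1)$, $$\zeta(s_1,\ldots,s_k;\sigma_1,\ldots,\sigma_k)=\lim_{n\to\infty}\sum_{n\geq n_1>n_2>\cdots>n_k\geq 1}\frac{\sigma_1^{n_1}\cdots\sigma_k^{n_k}}{n_1^{s_1}\cdots n_k^{s_k}}.$$ The exponents and signs are combined into a single string, with $s_j$ in the $j$th position when $\sigma_j=+1$ and $\bar{s}_j$ (or $\overline{s_j}$) in the $j$th position when $\sigma_j=-1$; e.g. $\zeta(\bar{s}_1,s_2)=\zeta(s_1,s_2;-1,1)$. $\chi_{\mathbb{N}}$ is the characteristic function of the set of positive integers: $\chi_{\mathbb{N}}(x)=1$ if $x$ is a positive integer and $0$ otherwise. $\mathcal{S}_m$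 is the symmetric group on $\{1,\ldots,m\}$; a composition of $m$ is an ordered tuple of positive integers summing to $m$, and $\mathcal{C}_m$ is the set of all compositions of $m$. For $c=1$, the empty sum $\theta_1+\cdots+\theta_{c-1}$ is $0$. *)

(* Defs.v *)
From mathcomp Require Import all_boot all_order all_algebra all_fingroup.
From mathcomp Require Import all_classical all_reals all_analysis.

Set Implicit Arguments.
Unset Strict Implicit.
Unset Printing Implicit Defensive.

Import Order.TTheory GRing.Theory Num.Theory.
Import numFieldNormedType.Exports.

Local Open Scope ring_scope.

(* The index set {1, ..., m} is 'I_m: the ordinal j stands for the 1-based    *)
(* index j + 1. The parts of a composition are likewise numbered from 0.      *)

Section EulerSums.
Variable R : realType.

Definition harmonic_number (n r : nat) : R :=
  \sum_(1 <= k < n.+1) (k%:R ^+ r)^-1.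

Definition alt_harmonic_number (n r : nat) : R :=
  \sum_(1 <= k < n.+1) (-1) ^+ k.-1 / k%:R ^+ r.

(* The exponents i j with j < l are unbarred, those with l <= j are barred.   *)
Definition euler_sum (m l : nat) (i : 'I_m -> nat) (q : nat) : R :=
  limn (fun N : nat => \sum_(1 <= n < N.+1)
    (\prod_(j < m | (j < l)%N) harmonic_number n (i j)) *
    (\prod_(j < m | (l <= j)%N) alt_harmonic_number n (i j)) / n%:R ^+ q).

(* A string of exponents and signs is a list of pairs (s, b), where b = true  *)
(* means that s is barred, i.e. that the sign is -1.                          *)
Definition bar_sign (b : bool) : R := if b then -1 else 1.

(* nn lists the summation indices n_1 > ... > n_k, bounded by N.              *)
Definition alt_mzv_partial (w : seq (nat * bool)) (N : nat) : R :=
  \sum_(nn : {ffun 'I_(size w) -> 'I_N.+1} |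
          [forall a : 'I_(size w), (0 < nn a)%N] &&
          [forall a : 'I_(size w), forall b : 'I_(size w), (a < b)%N ==> (nn b < nn a)%N])
    \prod_(a < size w)
      (bar_sign (nth (0%N, false) w a).2 ^+ nn a
       / (nn a)%:R ^+ (nth (0%N, false) w a).1).

Definition alt_mzv (w : seq (nat * bool)) : R := limn (alt_mzv_partial w).

End EulerSums.

Definition is_composition (m : nat) (theta : seq nat) : bool :=
  all (fun t => (0 < t)%N) theta && (sumn theta == m).

(* A composition of m has at most m parts, each of them at most m, so         *)
(* restricting to lists of type {bseq m of 'I_m.+1} loses nothing.            *)
Definition parts (m : nat) (theta : {bseq m of 'I_m.+1}) : seq nat :=
  [seq nat_of_ord t | t <- theta].

Definition compositions (m : nat) : {set {bseq m of 'I_m.+1}} :=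
  [set theta : {bseq m of 'I_m.+1} | is_composition m (parts theta)].

Definition chiN (x : int) : nat := (0 < x)%R.

Section Blocks.
Variables (m l : nat) (i : 'I_m -> nat) (q : nat).
Variables (theta : seq nat) (rho : 'S_m).

(* The c-th block consists of the positions
   theta_1 + ... + theta_(c-1) + k with 1 <= k <= theta_c.                    *)
Definition in_block (c : nat) (j : 'I_m) : bool :=
  (sumn (take c theta) <= j < sumn (take c theta) + nth 0%N theta c)%N.

Definition lambda (c : nat) : nat :=
  (\sum_(j < m | in_block c j) chiN ((rho j).+1%:Z - l%:Z))%N.

Definition block_weight (c : nat) : nat :=
  (\sum_(j < m | in_block c j) i (rho j))%N.

Definition T_tilde (c : nat) : nat * bool := (block_weight c, odd (lambda c)).

Definition T_hat1 : nat * bool := ((q + block_weight 0)%N, odd (lambda 0)).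

Definition zeta_args1 : seq (nat * bool) :=
  (q, false) :: [seq T_tilde c | c <- iota 0 (size theta)].

Definition zeta_args2 : seq (nat * bool) :=
  T_hat1 :: [seq T_tilde c | c <- iota 1 (size theta).-1].

End Blocks.

(* Main.v *)
(* Write each barred harmonic number as minus a sum of (-1)^k / k^r, so that the
   product of harmonic numbers at n becomes a sign times prod_a F_a(n), with
   F_a(n) the sum of f_a(k) over 1 <= k <= n. The heart of the matter is that
   prod_a F_a(n) is the sum over theta and rho of 1 / (theta_1! ... theta_p!)
   times the sum over n >= n_1 > ... > n_p >= 1 of the product over blocks c of
   the f_rho(j)(n_c), j in block c. For fixed theta and n_1, ..., n_p the sum over
   rho is a permanent; Ryser's formula writes it as an alternating sum, over
   subsets of indices, of the same expression with every f_a replaced by a single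
   function f. For a single f the identity is the expansion of F(n)^m / m!, by
   induction on n and the binomial theorem. A second use of Ryser's formula turns
   the alternating sum of the F(n)^m / m! back into prod_a F_a(n).
   Multiplying by n^-q and splitting the inner sums according to n > n_1 or
   n = n_1 gives the two zeta values, for partial sums. All these nested sums
   converge absolutely, since q >= 2 and the other exponents are positive. *)
Require Import Defs.
From mathcomp Require Import all_boot all_order all_algebra all_fingroup.
From mathcomp Require Import all_classical all_reals all_analysis.
From mathcomp Require Import ring lra zify.

Set Implicit Arguments.
Unset Strict Implicit.
Unset Printing Implicit Defensive.

Import Order.TTheory GRing.Theory Num.Theory.
Import numFieldNormedType.Exports.

Local Open Scope ring_scope.

(** * Nested sums over strictly decreasing indices *)

Lemma big_ffun_ord_recl (V : nmodType) (T : finType) (p : nat)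
    (P : pred {ffun 'I_p.+1 -> T}) (F : {ffun 'I_p.+1 -> T} -> V) :
  let cons x (g : {ffun 'I_p -> T}) :=
    [ffun a => oapp g x (unlift ord0 a)] in
  \sum_(g | P g) F g = \sum_x \sum_(g | P (cons x g)) F (cons x g).
Proof.
move=> cons.
rewrite pair_big_dep /=.
pose h (x : T * {ffun 'I_p -> T}) := cons x.1 x.2.
rewrite (reindex h) //=.
exists (fun g => (g ord0, [ffun a => g (lift ord0 a)])) => [[x g]|g] _.
  congr pair; first by rewrite /h ffunE unlift_none.
  by apply/ffunP => a; rewrite /h !ffunE liftK.
apply/ffunP => a; rewrite /h ffunE /=.
by case: unliftP => [b|] -> //=; rewrite ffunE.
Qed.

Section NestedSum.
Variable R : comPzRingType.

(** The largest index is chosen first and the others stay strictly below it, whence the bound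
    [n.-1]. This recursive form allows induction on the depth [p] and on [N]. *)
Fixpoint nested_sum (p : nat) (u : nat -> nat -> R) (N : nat) : R :=
  if p is p'.+1 then
    \sum_(1 <= n < N.+1) u 0%N n * nested_sum p' (fun c => u c.+1) n.-1
  else 1.

Lemma nested_sumS p u N :
  nested_sum p.+1 u N =
  \sum_(1 <= n < N.+1) u 0%N n * nested_sum p (fun c => u c.+1) n.-1.
Proof. by []. Qed.

Lemma nested_sumS0 p u : nested_sum p.+1 u 0 = 0.
Proof. by rewrite nested_sumS big_geq. Qed.

Lemma nested_sumSS p u N :
  nested_sum p.+1 u N.+1 =
  nested_sum p.+1 u N + u 0%N N.+1 * nested_sum p (fun c => u c.+1) N.
Proof. by rewrite !nested_sumS big_nat_recr. Qed.

Lemma eq_nested_sum p u v N :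
  (forall c n, (c < p)%N -> (0 < n)%N -> u c n = v c n) ->
  nested_sum p u N = nested_sum p v N.
Proof.
elim: p u v N => // p IHp u v N uv; rewrite !nested_sumS; apply: eq_big_nat => n /andP[n0 _].
congr (_ * _); first exact: uv.
by apply: IHp => c k cp k0; apply: uv.
Qed.

(** The bound [b] is kept apart from the type bound [M]: peeling off the largest index lowers [b]
    while the codomain stays fixed. *)
Definition decreasing_below p M b (nn : {ffun 'I_p -> 'I_M}) :=
  [forall a, (0 < nn a <= b)%N] &&
  [forall a : 'I_p, forall b : 'I_p, (a < b)%N ==> (nn b < nn a)%N].

Lemma sum_decreasing_below p (u : nat -> nat -> R) M b : (b <= M)%N ->
  \sum_(nn : {ffun 'I_p -> 'I_M.+1} | decreasing_below b nn)
    \prod_(a < p) u a (nn a) = nested_sum p u b.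
Proof.
elim: p u b => [|p IHp] u b bM.
  rewrite (big_pred1 [ffun => ord0]) ?big_ord0 // => nn.
  rewrite /decreasing_below; apply/idP/eqP => [_|_].
    by apply/ffunP => -[].
  by apply/andP; split; apply/forallP => -[].
rewrite nested_sumS big_ffun_ord_recl /= (bigID (fun x : 'I_M.+1 => (0 < x <= b)%N)) /=.
rewrite [X in _ + X]big1 ?addr0; last first.
  move=> x xb; rewrite big_pred0 // => g; apply/negP => /andP[/forallP/(_ ord0)].
  by rewrite ffunE unlift_none /= (negbTE xb).
transitivity (\sum_(x < M.+1 | (0 < x <= b)%N)
   u 0%N x * nested_sum p (fun c => u c.+1) x.-1).
  apply: eq_bigr => x /andP[x0 xb].
  rewrite -IHp ?big_distrr /=; last by lia.
  apply: eq_big => [g|g _].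
    apply/andP/andP => -[/forallP h1 /forallP h2]; split; apply/forallP => a.
    - have := h1 (lift ord0 a); have /forallP/(_ (lift ord0 a)) := h2 ord0.
      by rewrite !ffunE liftK unlift_none lift0 /= => gx /andP[-> _]; lia.
    - apply/forallP => c; have /forallP/(_ (lift ord0 c)) := h2 (lift ord0 a).
      by rewrite !ffunE !liftK !lift0 ltnS.
    - rewrite ffunE; case: unliftP => [c _|_] /=; last by rewrite x0.
      by have := h1 c; lia.
    - apply/forallP => c; rewrite !ffunE.
      case: (unliftP ord0 a) => [a' ->|->];
        case: (unliftP ord0 c) => [c' ->|->]; rewrite ?lift0 //=.
        by rewrite ltnS; have /forallP/(_ c') := h2 a'.
      by have := h1 c'; lia.
  rewrite big_ord_recl ffunE unlift_none /=; congr (_ * _).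
  by apply: eq_bigr => a _; rewrite ffunE liftK.
rewrite -(big_mkord (fun x => 0 < x <= b)%N
  (fun x => u 0%N x * nested_sum p (fun c => u c.+1) x.-1)).
rewrite /= [RHS](big_nat_widen _ _ M.+1) // [RHS](big_nat_widenl _ 0) //.
by apply: eq_bigl => x; rewrite ltnS; lia.
Qed.

End NestedSum.

Arguments nested_sum : simpl never.

Lemma alt_mzv_partialE (R : realType) w :
  alt_mzv_partial R w = nested_sum (size w) (fun a n =>
    bar_sign R (nth (0%N, false) w a).2 ^+ n / n%:R ^+ (nth (0%N, false) w a).1).
Proof.
apply/funext => N; rewrite -(@sum_decreasing_below _ _ _ N N) //.
apply: eq_bigl => nn; congr andb; apply: eq_forallb => a.
by rewrite leq_ord andbT.
Qed.

(** * Permanents and Ryser's formula *)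

Section Permanent.
Variables (R : comPzRingType) (m : nat).

(* Ryser's formula: the alternating sum over e kills the non-surjective maps
   in the expansion of the product. *)
Lemma ryser (A : 'I_m -> 'I_m -> R) :
  \sum_(s : 'S_m) \prod_j A (s j) j =
  \sum_(e : {ffun 'I_m -> bool}) (\prod_a (if e a then 1 else -1)) *
    \prod_j \sum_(a | e a) A a j.
Proof.
transitivity (\sum_(e : {ffun 'I_m -> bool}) (\prod_a (if e a then 1 else -1)) *
    \sum_(h : {ffun 'I_m -> 'I_m}) \prod_j ((e (h j))%:R * A (h j) j)); last first.
  apply: eq_bigr => e _; congr (_ * _).
  rewrite -(bigA_distr_bigA (fun j a => (e a)%:R * A a j)).
  apply: eq_bigr => j _; rewrite [RHS]big_mkcond; apply: eq_bigr => a _.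
  by case: (e a); rewrite ?mul1r ?mul0r.
under [RHS]eq_bigr => e _ do rewrite big_distrr /=.
rewrite [RHS]exchange_big /=.
have sgnE (h : {ffun 'I_m -> 'I_m}) :
    \sum_(e : {ffun 'I_m -> bool}) (\prod_a (if e a then 1 else -1)) *
      \prod_j ((e (h j))%:R * A (h j) j) =
    (injectiveb h)%:R * \prod_j A (h j) j.
  (* The factor at [a] is 1 if [a] is a value of [h] and 1 - 1 = 0 otherwise, so the product detects
     surjectivity, which for a self-map of a finite set is injectivity. *)
  have injE : \prod_a \sum_(b : bool)
      ((if b then 1 else -1) * (b || (a \notin codom h))%:R) =
      (injectiveb h)%:R :> R.
    under eq_bigr => a _ do rewrite big_bool /= mul1r.
    case: (boolP (injectiveb h)) => [/injectiveP hinj|hninj].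
      rewrite big1 // => a _.
      have /codomP[b ->] : a \in codom h.
        exact: inj_card_onto.
      by rewrite codom_f /= mulr0 addr0.
    have [a ah] : exists a, a \notin codom h.
      apply/existsP; move: hninj; apply: contraR; rewrite negb_exists => /forallP onto.
      have /image_injP hinj : #|codom h| == #|'I_m|.
        by apply/eqP/eq_card => a; have := onto a; rewrite negbK.
      by apply/injectiveP => a b; apply: hinj.
    by rewrite (bigD1 a) //= ah /= mulr1 subrr mul0r.
  rewrite -injE.
  rewrite (bigA_distr_bigA (fun a b => (if b then 1 else -1) * (b || (a \notin codom h))%:R)).
  rewrite big_distrl /=; apply: eq_bigr => e _.
  rewrite !big_split /= !mulrA; congr (_ * _ * _).
  (* Both remaining products are the indicator of [e] containing the image of [h]. *)
  case: (boolP [forall j, e (h j)]) => [/forallP eh|/forallPn[j ehj]].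
    rewrite !big1 // => [a|j] _; last by rewrite eh.
    by case: codomP => [[b ->]|]; rewrite ?eh // orbT.
  rewrite (bigD1 j) //= (negbTE ehj) mul0r (bigD1 (h j)) //=.
  by rewrite (negbTE ehj) codom_f mul0r.
under [RHS]eq_bigr => h _ do rewrite sgnE.
rewrite (bigID (fun h : {ffun 'I_m -> 'I_m} => injectiveb h)) /=.
rewrite [X in _ = _ + X]big1 ?addr0; last first.
  by move=> h /negbTE ->; rewrite mul0r.
rewrite (reindex (fun s : 'S_m => val s)) /=; last first.
  exists (insubd (1%g : 'S_m)) => [s _|h hi]; first by rewrite valKd.
  by rewrite insubdK.
apply: eq_big => [s|s _]; first by rewrite (valP s).
rewrite (valP s) mul1r; apply: eq_bigr => j _; by rewrite pvalE.
Qed.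

End Permanent.

(** * Compositions and powers of a single sum *)

(* The argument k is fuel: any k >= m gives all the compositions of m. *)
Fixpoint composition_seq (k m : nat) : seq (seq nat) :=
  if m is m'.+1 then
    if k is k'.+1 then
      [seq t.+1 :: th | t <- iota 0 m, th <- composition_seq k' (m' - t)]
    else [::]
  else [:: [::]].

Lemma composition_seqSS k m :
  composition_seq k.+1 m.+1 =
  [seq t.+1 :: th | t <- iota 0 m.+1, th <- composition_seq k (m - t)].
Proof. by []. Qed.

Lemma mem_composition_seq k m th : (m <= k)%N ->
  (th \in composition_seq k m) = is_composition m th.
Proof.
rewrite /is_composition; elim: k m th => [|k IHk] [|m] th // mk.
- by case: th => [|t th] //=; rewrite inE; apply/esym/negP => /andP[/andP[]]; lia.
- by case: th => [|t th] //=; rewrite inE; apply/esym/negP => /andP[/andP[]]; lia.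
rewrite composition_seqSS; case: th => [|t th].
  by apply/allpairsPdep => -[? [? []]].
apply/allpairsPdep/andP => [[x [y [xm yth [-> ->]]]]|[/andP[t0 th0] /eqP tm]].
  move: xm yth; rewrite mem_iota IHk; last by lia.
  by move=> xm /= /andP[yth /eqP ysum]; split; [rewrite yth|rewrite ysum; lia].
rewrite /= in t0 tm; exists t.-1, th; rewrite mem_iota IHk; last by lia.
split; [lia|apply/andP; split; [exact: th0|lia]|by rewrite prednK].
Qed.

Lemma uniq_composition_seq k m : uniq (composition_seq k m).
Proof.
elim: k m => [|k IHk] [|m] //.
rewrite composition_seqSS; apply: allpairs_uniq_dep => [|t _|]; last 1 first.
- by move=> [t th] [t' th'] _ _ [-> ->].
- exact: iota_uniq.
- exact: IHk.
Qed.

Lemma big_composition_seq (V : nmodType) k m (F : seq nat -> V) :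
  \sum_(th <- composition_seq k.+1 m.+1) F th =
  \sum_(t < m.+1) \sum_(th <- composition_seq k (m - t)) F (t.+1 :: th).
Proof.
rewrite composition_seqSS big_allpairs_dep.
by rewrite -[iota 0 m.+1]/(index_iota 0 m.+1) big_mkord.
Qed.

Lemma size_composition m th : is_composition m th -> (size th <= m)%N.
Proof.
case/andP => th0 /eqP <-; elim: th th0 => //= t th IHth /andP[t0 /IHth]; lia.
Qed.

(** Passes from the finite type of bounded sequences to a recursive list, on which the first part
    can be split off. *)
Lemma sum_compositions (V : nmodType) m (F : seq nat -> V) :
  \sum_(theta in compositions m) F (parts theta) =
  \sum_(th <- composition_seq m m) F th.
Proof.
rewrite -big_enum /= -(big_map (@parts m) xpredT); apply/perm_big/uniq_perm.
- rewrite map_inj_uniq ?enum_uniq // => x y /(inj_map val_inj) xy.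
  exact: val_inj.
- exact: uniq_composition_seq.
move=> th; rewrite mem_composition_seq //; apply/mapP/idP => [[x]|thm].
  by rewrite mem_enum inE => ? ->.
have sz : (size [seq (inord t : 'I_m.+1) | t <- th] <= m)%N.
  by rewrite size_map; apply: size_composition.
have thE : th = parts (Bseq sz).
  rewrite /parts /= -map_comp -[LHS]map_id; apply/eq_in_map => t tth /=.
  rewrite inordK // ltnS; case/andP: thm => _ /eqP <-.
  by elim: th tth {sz} => //= a th IHth; rewrite inE => /orP[/eqP ->|/IHth]; lia.
by exists (Bseq sz); rewrite // mem_enum inE -thE.
Qed.

Lemma sum_composition_powers (F : numFieldType) (f : nat -> F) N k m :
  (m <= k)%N ->
  \sum_(th <- composition_seq k m)
    (\prod_(t <- th) t`!)%:R^-1 *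
    nested_sum (size th) (fun c n => f n ^+ nth 0%N th c) N =
  (\sum_(1 <= n < N.+1) f n) ^+ m / m`!%:R.
Proof.
elim: N k m => [|N IHN] k [|m] mk.
- by case: k {mk} => [|k]; rewrite big_seq1 big_nil /= mulr1 expr0 mul1r.
- rewrite [in RHS]big_geq // expr0n mul0r big_seq big1 // => -[|t th].
    by rewrite mem_composition_seq // /is_composition.
  by rewrite [size _]/= nested_sumS0 mulr0.
- by case: k {mk} => [|k]; rewrite big_seq1 big_nil /= mulr1 expr0 mul1r.
case: k mk => // k mk; rewrite big_composition_seq.
transitivity (\sum_(t < m.+1)
    (\sum_(th <- composition_seq k (m - t)) (\prod_(x <- t.+1 :: th) x`!)%:R^-1 *
       nested_sum (size (t.+1 :: th)) (fun c n => f n ^+ nth 0%N (t.+1 :: th) c) N +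
     f N.+1 ^+ t.+1 / t.+1`!%:R * ((\sum_(1 <= n < N.+1) f n) ^+ (m - t) / (m - t)`!%:R))).
  apply: eq_bigr => t _; rewrite -(IHN k); last by lia.
  rewrite big_distrr -big_split; apply: eq_bigr => th _.
  rewrite [size _]/= nested_sumSS mulrDr big_cons natrM invfM /=.
  by congr (_ + _); ring.
rewrite big_split /= -(@big_composition_seq _ k m (fun th => (\prod_(x <- th) x`!)%:R^-1 *
       nested_sum (size th) (fun c n => f n ^+ nth 0%N th c) N)) IHN //.
(* The binomial term free of [f N.+1] is the case of largest index at most [N]; the term in
   [f N.+1 ^+ t.+1] is the case of first part [t.+1] placed at [N.+1]. *)
rewrite [in RHS]big_nat_recr //= exprDn.
rewrite [X in _ = X * _]big_ord_recl /= subn0 bin0 expr0 mulr1 mulr1n.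
rewrite mulrDl; congr (_ + _); rewrite mulr_suml; apply: eq_bigr => t _.
rewrite /bump /= add1n subSS -mulr_natr -(@bin_fact m.+1 t.+1) //.
rewrite subSS (natrM _ 'C(m.+1, t.+1)) (natrM _ t.+1`!).
have h1 : t.+1`!%:R != 0 :> F by rewrite pnatr_eq0 -lt0n fact_gt0.
have h2 : (m - t)`!%:R != 0 :> F by rewrite pnatr_eq0 -lt0n fact_gt0.
have h3 : 'C(m.+1, t.+1)%:R != 0 :> F by rewrite pnatr_eq0 -lt0n bin_gt0.
move: (t.+1`!) ((m - t)`!) 'C(m.+1, t.+1) h1 h2 h3 => a b c h1 h2 h3.
by field; rewrite h1 h2 h3.
Qed.

(** * Blocks of a composition and the expansion of a product of sums *)

Lemma in_block_unique m theta (j : 'I_m) : is_composition m theta ->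
  exists c0 : 'I_(size theta), forall c, in_block theta c j = (c == c0).
Proof.
case/andP => _ /eqP sm; have : (j < sumn theta)%N by rewrite sm.
rewrite /in_block; move: (nat_of_ord j) => {sm} {}j.
elim: theta j => // t th IHth j; have [jt _|tj] := ltnP j t.
  by exists ord0 => -[|c] /=; rewrite ?eqE /=; lia.
rewrite [sumn _]/= => jth; have [|c0 IHc0] := IHth (j - t)%N; first by lia.
exists (lift ord0 c0) => -[|c]; rewrite lift0 /=; first by lia.
by rewrite eqSS -IHc0; lia.
Qed.

Lemma card_in_block m theta (c : 'I_(size theta)) : is_composition m theta ->
  #|[pred j : 'I_m | in_block theta c j]| = nth 0%N theta c.
Proof.
case/andP => _ /eqP sm; set x := sumn (take c theta).
have xm : (x + nth 0%N theta c <= m)%N.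
  rewrite -sm -[in X in (_ <= X)%N](cat_take_drop c theta) sumn_cat.
  by rewrite (drop_nth 0%N (ltn_ord c)) /=; lia.
rewrite -sum1_card -(big_mkord (fun j => x <= j < x + nth 0%N theta c)%N (fun=> 1%N)) /=.
transitivity (\sum_(x <= j < x + nth 0%N theta c) 1)%N.
  rewrite [RHS](big_nat_widen _ _ m) // [RHS](big_nat_widenl _ 0) //.
  by apply: eq_bigl => j /=; rewrite andbC.
by rewrite sum_nat_const_nat; lia.
Qed.

(** For fixed indices [nn], the sum over [rho] is the permanent of the matrix whose entry (a, j) is
    [f a (nn c)], with c the block of j. In Ryser's formula the columns of one block give equal
    factors, hence a power with exponent the block length. *)
Lemma sum_perm_nested_sum (R : comPzRingType) m theta (f : 'I_m -> nat -> R) N :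
  is_composition m theta ->
  \sum_(rho : 'S_m) nested_sum (size theta)
    (fun c n => \prod_(j < m | in_block theta c j) f (rho j) n) N =
  \sum_(e : {ffun 'I_m -> bool}) (\prod_a (if e a then 1 else -1)) *
    nested_sum (size theta) (fun c n => (\sum_(a | e a) f a n) ^+ nth 0%N theta c) N.
Proof.
move=> thm.
under eq_bigr => rho _ do rewrite -(sum_decreasing_below _ _ (leqnn N)).
rewrite exchange_big /=.
under [RHS]eq_bigr => e _.
  rewrite -(sum_decreasing_below _ _ (leqnn N)) big_distrr /=.
  over.
rewrite [RHS]exchange_big /=; apply: eq_bigr => nn _.
under eq_bigr => rho _.
  rewrite (exchange_big_dep xpredT) //=.
  over.
rewrite (ryser (fun a j => \prod_(c < size theta | in_block theta c j) f a (nn c))).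
apply: eq_bigr => e _; congr (_ * _).
under [RHS]eq_bigr => c _ do rewrite -(card_in_block _ thm) -prodr_const.
rewrite [RHS](exchange_big_dep xpredT) //=; apply: eq_bigr => j _.
have [c0 jc0] := in_block_unique j thm.
have jE (c : 'I_(size theta)) : in_block theta c j = (c == c0) by apply: jc0.
rewrite [RHS](big_pred1 c0); last exact: jE.
by apply: eq_bigr => a _; apply: big_pred1; apply: jE.
Qed.

Lemma prod_sum_nested_sum (F : numFieldType) m (f : 'I_m -> nat -> F) N :
  \prod_a \sum_(1 <= n < N.+1) f a n =
  \sum_(theta in compositions m) \sum_(rho : 'S_m)
    (\prod_(t <- parts theta) t`!)%:R^-1 * nested_sum (size (parts theta))
      (fun c n => \prod_(j < m | in_block (parts theta) c j) f (rho j) n) N.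
Proof.
rewrite (sum_compositions m (fun th : seq nat => \sum_(rho : 'S_m)
    (\prod_(t <- th) t`!)%:R^-1 * nested_sum (size th)
      (fun c n => \prod_(j < m | in_block th c j) f (rho j) n) N)).
transitivity (\sum_(e : {ffun 'I_m -> bool}) (\prod_a (if e a then 1 else -1)) *
  \sum_(th <- composition_seq m m) (\prod_(t <- th) t`!)%:R^-1 *
    nested_sum (size th) (fun c n => (\sum_(a | e a) f a n) ^+ nth 0%N th c) N).
  under [RHS]eq_bigr => e _.
    rewrite (sum_composition_powers (fun n => \sum_(a | e a) f a n)) // exchange_big /= mulrA.
    rewrite -[X in _ ^+ X](card_ord m) -prodr_const.
    over.
  (* Here the matrix has equal columns, so each of the m! permutations contributes the same product,
     and the factor 1/m! cancels their number. *)
  rewrite -mulr_suml -(ryser (fun a _ => \sum_(1 <= n < N.+1) f a n)).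
  apply: (mulIf (x := m`!%:R)); first by rewrite pnatr_eq0 -lt0n fact_gt0.
  rewrite divfK ?pnatr_eq0 -?lt0n ?fact_gt0 // mulr_natr.
  rewrite -[in LHS]card_Sn -sumr_const; apply: eq_big => [s|s _].
    by rewrite inE.
  by rewrite [LHS](reindex_inj (@perm_inj _ s)).
under eq_bigr => e _ do rewrite big_distrr /=.
rewrite exchange_big /= big_seq [RHS]big_seq; apply: eq_bigr => th.
rewrite mem_composition_seq // => thm.
under eq_bigr => e _ do rewrite mulrCA.
by rewrite -!big_distrr /= sum_perm_nested_sum.
Qed.

(** * Absolute convergence of nested sums *)

Section Convergence.
Variable R : realType.
Implicit Types (u v : nat -> nat -> R) (p N : nat).

Lemma ler_norm_nested_sum p u v N :
  (forall c n, (c < p)%N -> (0 < n)%N -> `|u c n| <= v c n) ->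
  `|nested_sum p u N| <= nested_sum p v N.
Proof.
elim: p u v N => [|p IHp] u v N uv; first by rewrite normr1.
rewrite !nested_sumS (le_trans (ler_norm_sum _ _ _)) // ler_sum_nat // => n /andP[n0 _].
by rewrite normrM ler_pM ?uv // IHp // => c k cp; apply: uv.
Qed.

Lemma nested_sum_ge0 p u N : (forall c n, 0 <= u c n) -> 0 <= nested_sum p u N.
Proof.
elim: p u N => [|p IHp] u N u0; first exact: ler01.
by apply: sumr_ge0 => n _; rewrite mulr_ge0 // IHp.
Qed.

(** For positive N, 1/(N+1)^2 is at most 1/(N(N+1)) = 1/N - 1/(N+1). At N = 0, where the inverse of
    0 is 0, the left side equals 2. *)
Lemma telescoping_inv_sqr (N : nat) :
  (N.+1%:R ^+ 2)^-1 + N.+1%:R^-1 <= (if N is 0 then 2 else N%:R^-1) :> R.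
Proof.
case: N => [|N]; first by rewrite invr1 expr1n invr1.
have x0 : (0 : R) < N.+1%:R by rewrite ltr0n.
rewrite -[N.+2]addn1 natrD; move: N.+1%:R x0 => x x0.
rewrite -subr_ge0.
have -> : x^-1 - (((x + 1) ^+ 2)^-1 + (x + 1)^-1) = (x * (x + 1) ^+ 2)^-1.
  by field; rewrite !gt_eqF // addr_gt0.
by rewrite invr_ge0 mulr_ge0 ?sqr_ge0 // ltW.
Qed.

(* Summing over n_1 > n_2 turns n_1^-2 n_2^-1 into at most n_2^-2; the extra
   term 1/N times the unrestricted sum makes this an induction on N. *)
Lemma nested_sum_inv_sqr_le2 p N :
  nested_sum p.+1 (fun c n => (n%:R ^+ (if c is 0%N then 2 else 1))^-1) N
    <= 2 :> R.
Proof.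
elim: p N => [|p IHp] N.
  (* The added 1/N makes the quantity equal to 1 + 1 at N = 1 and nonincreasing from there on. *)
  suff : nested_sum 1 (fun c n => (n%:R ^+ (if c is 0%N then 2 else 1))^-1) N
    + N%:R^-1 <= 2 :> R by apply: le_trans; rewrite lerDl invr_ge0.
  elim: N => [|N IHN]; first by rewrite nested_sumS0 invr0 addr0.
  rewrite nested_sumSS mulr1.
  have := telescoping_inv_sqr N; case: N IHN => [|N] IHN.
    by rewrite nested_sumS0; lra.
  by move=> h; apply: le_trans IHN; rewrite -addrA lerD2l.
apply: le_trans (IHp N).
suff : nested_sum p.+2 (fun c n => (n%:R ^+ (if c is 0%N then 2 else 1))^-1) N
    + nested_sum p.+1 (fun _ n => (n%:R ^+ 1)^-1) N * N%:R^-1 <=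
  nested_sum p.+1 (fun c n => (n%:R ^+ (if c is 0%N then 2 else 1))^-1) N :> R.
  apply: le_trans; rewrite lerDl mulr_ge0 ?invr_ge0 //.
  by apply: nested_sum_ge0 => c n; rewrite invr_ge0 exprn_ge0.
elim: N => [|N IHN]; first by rewrite !nested_sumS0 mul0r addr0.
rewrite [X in X + _]nested_sumSS [X in _ + X * _]nested_sumSS [leRHS]nested_sumSS.
rewrite -[nested_sum p.+1 (fun c => _) N]/(nested_sum p.+1 (fun _ n => (n%:R ^+ 1)^-1) N).
set T := nested_sum p.+1 (fun _ n => _) N in IHN *.
set A := nested_sum p _ N.
set S := nested_sum p.+2 _ N in IHN *; set U := nested_sum p.+1 _ N in IHN *.
have TN : T * ((N.+1%:R ^+ 2)^-1 + N.+1%:R^-1) <= T * N%:R^-1.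
  have T0 : 0 <= T by apply: nested_sum_ge0 => c n; rewrite invr_ge0 exprn_ge0.
  (* At N = 0 the inverse of [N] is 0 and the telescoping bound does not apply, but [T] is then an
     empty sum. *)
  have [N0|N0] := posnP N; first by rewrite /T N0 nested_sumS0 !mul0r.
  by rewrite ler_wpM2l //; have := telescoping_inv_sqr N; case: (N) N0.
change (S + (N.+1%:R ^+ 2)^-1 * T + (T + (N.+1%:R ^+ 1)^-1 * A) * N.+1%:R^-1
  <= U + (N.+1%:R ^+ 2)^-1 * A).
rewrite expr1; move: TN; rewrite -exprVn.
move: (N.+1%:R^-1) (N%:R^-1) IHN => y x IHN TN.
suff -> : S + y ^+ 2 * T + (T + y * A) * y = S + T * (y ^+ 2 + y) + y ^+ 2 * A by lra.
by ring.
Qed.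

(** The outermost sum is a series. Its absolute values are dominated termwise by the model sum with
    exponents 2, 1, ..., 1, whose partial sums are at most 2. *)
Lemma is_cvg_nested_sum p u :
  (forall c n, (c < p.+1)%N -> (0 < n)%N ->
    `|u c n| <= (n%:R ^+ (if c is 0%N then 2 else 1))^-1) ->
  cvgn (nested_sum p.+1 u).
Proof.
move=> uv; pose w k := u 0%N k.+1 * nested_sum p (fun c => u c.+1) k.
have -> : nested_sum p.+1 u = series w.
  by apply/funext => N; rewrite nested_sumS /series /= big_add1.
apply/normed_cvg/nondecreasing_is_cvgn.
  by apply/nondecreasing_seqP => n; rewrite [leRHS]seriesSr lerDl; exact: normr_ge0.
exists 2; move=> _ [N _ <-]; apply: le_trans (nested_sum_inv_sqr_le2 p N).
rewrite /series nested_sumS [leRHS]big_add1 /=; apply: ler_sum => k _.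
by rewrite normrM ler_pM ?uv // ler_norm_nested_sum // => c n cp; apply: uv.
Qed.

End Convergence.

(** * Euler sums in terms of alternating zeta values *)

Lemma block_weight_gt0 m (i : 'I_m -> nat) theta rho c :
  (forall j, 0 < i j)%N -> is_composition m theta -> (c < size theta)%N ->
  (0 < block_weight i theta rho c)%N.
Proof.
move=> i0 thm cth; apply: (@leq_trans (nth 0%N theta c)).
  by case/andP: thm => /allP th0 _; apply/th0/mem_nth.
rewrite -(card_in_block (Ordinal cth) thm) -sum1_card.
exact: leq_sum.
Qed.

(** Each barred index lies in exactly one block, so the sign in the formula depends on neither
    [theta] nor [rho]. *)
Lemma sum_lambda m l theta (rho : 'S_m) : is_composition m theta ->
  (\sum_(0 <= c < size theta) lambda l theta rho c)%N = (\sum_(j < m) (l <= j))%N.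
Proof.
move=> thm; rewrite big_mkord (exchange_big_dep xpredT) //=.
rewrite [RHS](reindex_inj (@perm_inj _ rho)); apply: eq_bigr => j _.
have [c0 jc0] := in_block_unique j thm.
rewrite (big_pred1 c0) => [|c]; last exact: jc0.
by rewrite /chiN subr_gt0 ltz_nat ltnS.
Qed.

Section EulerSum.
Variable R : realType.

Lemma bar_signE b : bar_sign R b = (-1) ^+ b.
Proof. by case: b; rewrite /bar_sign. Qed.

Definition mzv_term (s : nat * bool) (n : nat) : R := bar_sign R s.2 ^+ n / n%:R ^+ s.1.

Lemma is_cvg_alt_mzv s w :
  (2 <= s.1)%N -> all (fun t => 0 < t.1)%N w -> cvgn (alt_mzv_partial R (s :: w)).
Proof.
move=> s2 /allP w0; rewrite alt_mzv_partialE.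
apply: is_cvg_nested_sum => c n cw n0.
rewrite bar_signE normrM normrX normrX normrN1 !expr1n mul1r normfV normrX normr_nat.
rewrite lef_pV2 ?posrE ?exprn_gt0 ?ltr0n // ler_weXn2l ?ler1n //.
case: c cw => [|c cw] //=.
by apply: w0; apply: mem_nth.
Qed.

(** All functions of a block are evaluated at the same [n]: exponents add, signs multiply, and only
    the parity of [lambda] survives. *)
Lemma prod_mzv_term m l (i : 'I_m -> nat) theta (rho : 'S_m) c n :
  \prod_(j < m | in_block theta c j) mzv_term (i (rho j), (l <= rho j)%N) n =
  mzv_term (T_tilde l i theta rho c) n.
Proof.
rewrite /mzv_term prodf_div prodrXl prodrXr; congr (_ ^+ _ / _).
rewrite bar_signE signr_odd -prodrXr; apply: eq_bigr => j _.
by rewrite bar_signE /chiN subr_gt0 ltz_nat ltnS.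
Qed.

(** In the inner sum up to [n], the indices below [n] give [zeta_args1]; a largest index equal to
    [n] merges the exponent [q] with the first block and gives [zeta_args2]. *)
Lemma alt_mzv_partial_zeta_args m l (i : 'I_m -> nat) q theta (rho : 'S_m) N :
  (0 < size theta)%N ->
  alt_mzv_partial R (zeta_args1 l i q theta rho) N +
    alt_mzv_partial R (zeta_args2 l i q theta rho) N =
  \sum_(1 <= n < N.+1) (n%:R ^+ q)^-1 *
    nested_sum (size theta) (fun c => mzv_term (T_tilde l i theta rho c)) n.
Proof.
rewrite !alt_mzv_partialE /zeta_args1 /zeta_args2 [size (_ :: _)]/= [size (_ :: _)]/=.
rewrite !size_map !size_iota; case: (size theta) => // p _.
rewrite !nested_sumS -big_split; apply: eq_big_nat => -[|n] // _ /=.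
set W := fun c => mzv_term _.
have nthT k c a : (c < a)%N -> nth (0%N, false)
    [seq T_tilde l i theta rho b | b <- iota k a] c = T_tilde l i theta rho (k + c).
  by move=> ca; rewrite (nth_map 0%N) ?size_iota // nth_iota.
rewrite (@eq_nested_sum _ p.+1 _ W) => [|c k cp _]; last by rewrite (nthT 0%N c p.+1).
rewrite (@eq_nested_sum _ p _ (fun c => W c.+1)) => [|c k cp _]; last first.
  by rewrite nthT.
rewrite nested_sumSS mulrDr expr1n mul1r.
congr (_ + _); rewrite mulrA; congr (_ * _).
by rewrite /W /mzv_term /= exprD invfM mulrCA.
Qed.

Lemma prod_harmonic_number m l (i : 'I_m -> nat) n :
  (\prod_(j < m | (j < l)%N) harmonic_number R n (i j)) *
  (\prod_(j < m | (l <= j)%N) alt_harmonic_number R n (i j)) =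
  (-1) ^+ (\sum_(j < m) (l <= j))%N *
  \prod_(j < m) \sum_(1 <= k < n.+1) mzv_term (i j, (l <= j)%N) k.
Proof.
rewrite -prodrXr -big_split [RHS](bigID (fun j : 'I_m => (j < l)%N)) /=.
congr (_ * _).
  apply: eq_bigr => j jl; rewrite leqNgt jl mul1r; apply: eq_bigr => k _.
  by rewrite /mzv_term /= expr1n mul1r.
apply: eq_big => [j|j lj]; first by rewrite -leqNgt.
rewrite lj mulr_sumr; apply: eq_big_nat => -[|k] // _.
by rewrite /mzv_term /= expr1 exprS !mulrA mulN1r opprK mul1r.
Qed.

End EulerSum.

Theorem theorem4p2 (R : realType) (m l : nat) (i : 'I_m -> nat) (q : nat)
    (hm : (1 <= m)%N) (hlm : (l <= m)%N)
    (hi_pos : forall j : 'I_m, (1 <= i j)%N)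
    (hi_unbarred : forall j k : 'I_m, (j <= k)%N -> (k < l)%N -> (i j <= i k)%N)
    (hi_barred : forall j k : 'I_m, (l <= j)%N -> (j <= k)%N -> (i j <= i k)%N)
    (hq : (2 <= q)%N) :
  euler_sum R l i q =
    \sum_(theta in compositions m) \sum_(rho : 'S_m)
      (-1) ^+ (\sum_(0 <= c < size (parts theta)) lambda l (parts theta) rho c)%N
      / (\prod_(t <- parts theta) t`!)%:R
      * (alt_mzv R (zeta_args1 l i q (parts theta) rho)
         + alt_mzv R (zeta_args2 l i q (parts theta) rho)).
Proof.
have size_gt0 theta : theta \in compositions m -> (0 < size (parts theta))%N.
  rewrite inE => /andP[_ /eqP]; case: parts => //= ; lia.
rewrite /euler_sum [X in limn X](_ : _ = fun N =>
  \sum_(theta in compositions m) \sum_(rho : 'S_m)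
    (-1) ^+ (\sum_(0 <= c < size (parts theta)) lambda l (parts theta) rho c)%N
    / (\prod_(t <- parts theta) t`!)%:R
    * (alt_mzv_partial R (zeta_args1 l i q (parts theta) rho) N
       + alt_mzv_partial R (zeta_args2 l i q (parts theta) rho) N)); last first.
  apply/funext => N.
  transitivity (\sum_(1 <= n < N.+1) \sum_(theta in compositions m) \sum_(rho : 'S_m)
      (-1) ^+ (\sum_(j < m) (l <= j))%N * ((\prod_(t <- parts theta) t`!)%:R^-1 *
      nested_sum (size (parts theta))
        (fun c => mzv_term R (T_tilde l i (parts theta) rho c)) n) / n%:R ^+ q).
    apply: eq_bigr => n _.
    rewrite prod_harmonic_number prod_sum_nested_sum mulr_sumr mulr_suml.
    apply: eq_bigr => theta _; rewrite mulr_sumr mulr_suml; apply: eq_bigr => rho _.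
    by congr (_ * (_ * _) / _); apply: eq_nested_sum => c k _ _; apply: prod_mzv_term.
  rewrite exchange_big /=; apply: eq_bigr => theta thm.
  rewrite exchange_big /=; apply: eq_bigr => rho _.
  rewrite alt_mzv_partial_zeta_args ?size_gt0 // mulr_sumr.
  rewrite sum_lambda; last by move: thm; rewrite inE.
  by apply: eq_bigr => n _; ring.
(* The identity now holds at every [N]; the limit passes through the finite sums because each zeta
   partial sum converges, its leading exponent being at least [q]. *)
apply/cvg_lim => //; apply: cvg_big => [|theta thm]; first exact: add_continuous.
apply: cvg_big => [|rho _]; first exact: add_continuous.
have w0 r c : (c < size (parts theta))%N ->
    (0 < (T_tilde l i (parts theta) r c).1)%N.
  by apply: block_weight_gt0 => //; move: thm; rewrite inE.
apply: cvgMl_tmp; apply: cvgD; apply: is_cvg_alt_mzv => //=.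
- by apply/allP => _ /mapP[c + ->]; rewrite mem_iota => /andP[_]; apply: w0.
- by rewrite ltn_addr.
- apply/allP => _ /mapP[c + ->]; rewrite mem_iota => /andP[_ cth]; apply: w0.
  by have := size_gt0 _ thm; lia.
Qed.
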